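(* Let $X$ be an infinite dimensional, separable $F$-space and $T\in\mathcal{L}(X)$. Then $(X,T)$ is strongly product transitive if and only if there exists a dense set $D\subset X$ such that the following conditions hold: (i) For every $x\in D$ there exists $n\in\mathbb{N}$ such that $T^n(x)=0$. (ii) For any finite set $\{y_1,\dots,y_n\}\subset X$ there exists a sequence $(n_k)$ in $\mathbb{N}$ such that for every $i\in\{1,\dots,n\}$ there is a sequence of points $(y^i_k)_k$ in $X$ with $y^i_k\in T^{-n_k}(y_i)$ for every $k$ and $y^i_k\to 0$ as $k\to\infty$.
   Context: $\mathbb{N}=\{1,2,3,\dots\}$. $\mathcal{L}(X)$ is the set of all bounded (i.e. continuous) linear operators on $X$. $T^{-n}(y)=\{z\in X:T^n(z)=y\}$ ($T$ is not assumed invertible). A system $(Y,R)$ is strongly transitive if for every non-empty open $U\subset Y$, $\bigcup_{m=1}^{\infty}R^m(U)=Y$. $(X,T)$ is strongly product transitive if for every $n\in\mathbb{N}$ the $n$-fold product system $(X\times\cdots\times X,\,T\times\cdots\times T)$ is strongly transitive. *)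

(* Defs.v *)
From mathcomp Require Import all_boot all_order all_algebra.
From mathcomp Require Import complex.
From mathcomp Require Import all_classical all_reals all_analysis.
Set Implicit Arguments.
Unset Strict Implicit.
Unset Printing Implicit Defensive.
Import Order.TTheory GRing.Theory Num.Theory.
Import numFieldNormedType.Exports.
Local Open Scope classical_set_scope.
Local Open Scope ring_scope.

(* The two scalar fields of the theory of F-spaces: the complex numbers when c
   is true, the reals when c is false. *)
Definition scalar_field (R : realType) (c : bool) : numFieldType :=
  if c then (R[i] : numFieldType) else (R : numFieldType).

(* The metric is real-valued whatever the scalar field K is, so it is not a
   metric in the sense of a library structure over K. *)
Record fspace_metric (R : realType) (K : numFieldType)
    (X : topologicalLmodType K) (d : X -> X -> R) : Prop := FSpaceMetric {
  fspace_dist_ge0 : forall x y, 0 <= d x y;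
  fspace_dist_eq0 : forall x y, d x y = 0 <-> x = y;
  fspace_dist_sym : forall x y, d x y = d y x;
  fspace_dist_triangle : forall x y z, d x z <= d x y + d y z;
  fspace_dist_translation : forall x y z, d (x + z) (y + z) = d x y;
  fspace_nbhsE : forall (x : X) (A : set X),
    nbhs x A <-> exists2 e : R, 0 < e & [set y | d x y < e] `<=` A;
  fspace_complete : forall u : nat -> X,
    (forall e : R, 0 < e ->
       exists N : nat, forall m n : nat,
         (N <= m)%N -> (N <= n)%N -> d (u m) (u n) < e) ->
    exists l : X, u @ \oo --> l
}.

(* A topological vector space whose topology comes from a complete
   translation-invariant metric; local convexity is not required, so X is not
   assumed to be a tvsType. *)
Definition F_space (R : realType) (K : numFieldType)
    (X : topologicalLmodType K) : Prop :=
  exists d : X -> X -> R, fspace_metric d.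

Definition separable (Y : topologicalType) :=
  exists2 A : set Y, countable A & dense A.

Definition infinite_dimensional (K : numFieldType) (V : lmodType K) :=
  forall (n : nat) (v : 'I_n -> V),
    ~ (forall x : V, exists c : 'I_n -> K, x = \sum_(i < n) c i *: v i).

Definition strongly_transitive (Y : topologicalType) (F : Y -> Y) :=
  forall U : set Y, open U -> U !=set0 ->
    \bigcup_(m in [set m | (0 < m)%N]) (iter m F @` U) = setT.

Definition product_map (X : topologicalType) (n : nat) (F : X -> X) :
  {ptws 'I_n -> X} -> {ptws 'I_n -> X} := fun x i => F (x i).

Definition strongly_product_transitive (X : topologicalType) (F : X -> X) :=
  forall n : nat, (0 < n)%N -> strongly_transitive (@product_map X n F).

(* Main.v *)
(* If T^N x = 0 and T^m z = y with m >= N, then T^m (x + z) = y: perturbing a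
   point of D by a small preimage of y stays inside a given open set and hits y.
   Condition (ii) supplies small preimages of large order, since a continuous
   linear map cannot send a sequence tending to 0 to a fixed nonzero y with
   bounded exponents; the target y = 0 is trivial. *)
Require Import Defs.
From mathcomp Require Import all_boot all_order all_algebra.
From mathcomp Require Import complex.
From mathcomp Require Import all_classical all_reals all_analysis.
Set Implicit Arguments.
Unset Strict Implicit.
Unset Printing Implicit Defensive.
Import Order.TTheory GRing.Theory Num.Theory.
Import numFieldNormedType.Exports.
Local Open Scope classical_set_scope.
Local Open Scope ring_scope.

(** The sets containing a box around [u] form a filter, so it is enough that this filter converges
    to [u]. As the topology is a supremum of initial topologies, this can be tested one coordinate
    at a time. Only an inclusion is claimed, so an infinite [I] is harmless. *)
Lemma nbhs_ptws_box (I : Type) (Y : topologicalType) (u : {ptws I -> Y})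
    (A : set {ptws I -> Y}) : nbhs u A ->
  exists2 V : I -> set Y, (forall i, nbhs (u i) (V i)) &
    [set x | forall i, V i (x i)] `<=` A.
Proof.
pose F : set_system {ptws I -> Y} :=
  filter_from [set V : I -> set Y | forall i, nbhs (u i) (V i)]
              (fun V => [set x | forall i, V i (x i)]).
have FF : Filter F.
  apply: filter_from_filter; first by exists (fun=> setT) => i; exact: filterT.
  move=> V W nV nW; exists (fun i => V i `&` W i) => [i|x VW].
    by apply: filterI; [exact: nV|exact: nW].
  by split=> i; have [] := VW i.
suff Fu : F --> u by move=> /Fu.
apply/cvg_sup => i B /= [_ [[C oC <-] Cu] CB].
(* This box constrains the coordinate [i] alone; the implication avoids a decidable equality on
   [I]. *)
exists (fun j => [set y | j = i -> C y]).
  move=> j; have [ji|ji] := pselect (j = i).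
    rewrite ji; apply: (@filterS _ _ _ C); first by move=> y Cy _.
    exact: open_nbhs_nbhs.
  by apply: (@filterS _ _ _ setT); [move=> y _ /ji|exact: filterT].
by move=> x Vx; apply: CB; exact: Vx.
Qed.

Lemma open_ptws_box (I : finType) (Y : topologicalType) (V : set Y) :
  open V -> open [set x : {ptws I -> Y} | forall i, V (x i)].
Proof.
move=> oV; rewrite openE => x Vx.
apply: (@filter_forall _ _ (fun i (z : {ptws I -> Y}) => V (z i)) (nbhs x)) => i.
apply: (@proj_continuous I (fun=> Y) i x); apply: open_nbhs_nbhs.
by split=> //; exact: Vx.
Qed.

Lemma iter_product_map (Y : topologicalType) (n m : nat) (F : Y -> Y)
    (x : {ptws 'I_n -> Y}) (i : 'I_n) :
  iter m (@product_map Y n F) x i = iter m F (x i).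
Proof. by elim: m => //= m <-. Qed.

Lemma continuous_iter (Y : topologicalType) (F : Y -> Y) (m : nat) :
  continuous F -> continuous (iter m F).
Proof.
move=> cF; elim: m => [|m IH] x; first exact: cvg_id.
by apply: (@continuous_comp _ _ _ (iter m F) F); [exact: IH|exact: cF].
Qed.

Section linear_iterates.
Context (K : numFieldType) (X : topologicalLmodType K) (T : {linear X -> X}).

Lemma iter_linear0 (m : nat) : iter m T 0 = 0.
Proof. by elim: m => //= m ->; rewrite linear0. Qed.

Lemma iter_linearD (m : nat) (x y : X) :
  iter m T (x + y) = iter m T x + iter m T y.
Proof. by elim: m => //= m ->; rewrite linearD. Qed.

Lemma iter_eq0_leq (m n : nat) (x : X) :
  (m <= n)%N -> iter m T x = 0 -> iter n T x = 0.
Proof. by move=> /subnK <- mx; rewrite iterD mx iter_linear0. Qed.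

(** Every iterate of [T] fixes 0 and is continuous there, so the finitely many iterates of order at
    most [M] all miss [y] on one common neighbourhood of 0. Once [z k] lies in it, [nu k] must
    exceed [M]. *)
Lemma small_preimage_exponent_gt (y : X) (nu : nat -> nat) (z : nat -> X)
    (M : nat) :
  continuous T -> nbhs (0 : X) (~` [set y]) ->
  (forall k, iter (nu k) T (z k) = y) -> z @ \oo --> (0 : X) ->
  \forall k \near \oo, (M < nu k)%N.
Proof.
move=> cT ny zy z0.
pose S := [set x | forall m : 'I_M.+1, iter m T x <> y].
have /z0 : nbhs (0 : X) S.
  apply: (@filter_forall _ _ (fun (m : 'I_M.+1) x => iter m T x <> y)) => m.
  have := @continuous_iter X T m cT 0; rewrite /continuous_at iter_linear0.
  by move=> /(_ _ ny).
apply: (@filterS _ _ _ (z @^-1` S)) => k /= zk; rewrite ltnNge.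
apply/negP => nuM; have := zk (inord (nu k)); rewrite inordK// zy.
Qed.

End linear_iterates.

Lemma fspace_nbhs_neq (R : realType) (K : numFieldType)
    (X : topologicalLmodType K) (x y : X) :
  F_space R X -> x <> y -> nbhs x (~` [set y]).
Proof.
move=> [d dX] xy; apply/(fspace_nbhsE dX).
exists (d x y); last by move=> z /= xz zy; rewrite zy ltxx in xz.
by rewrite lt_neqAle (fspace_dist_ge0 dX) andbT eq_sym; apply/eqP => /(fspace_dist_eq0 dX).
Qed.

(** Balls of radius 1/(k+1) do this. The lemma turns a choice of one point per neighbourhood into a
    convergent sequence. *)
Lemma fspace_countable_nbhs (R : realType) (K : numFieldType)
    (X : topologicalLmodType K) (x : X) : F_space R X ->
  exists2 V : nat -> set X, (forall k, nbhs x (V k)) &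
    forall z : nat -> X, (forall k, V k (z k)) -> z @ \oo --> x.
Proof.
move=> [d dX]; exists (fun k => [set y | d x y < k.+1%:R^-1]) => [k|z zV A].
  by apply/(fspace_nbhsE dX); exists k.+1%:R^-1 => //; rewrite invr_gt0.
move=> /(fspace_nbhsE dX)[e e0 eA].
apply: filterS (near_infty_natSinv_lt (PosNum e0)) => k /= ke.
by apply: eA; exact: lt_trans (zV k) ke.
Qed.

Section equivalence.
Context (K : numFieldType) (X : topologicalLmodType K) (T : {linear X -> X}).

(** Condition (ii), with a finite set given as an indexed family; repeated values do no harm. *)
Definition small_preimages := forall (n : nat) (y : 'I_n -> X), (0 < n)%N ->
  exists nu : nat -> nat,
    (forall k, (0 < nu k)%N) /\
    forall i : 'I_n, exists z : nat -> X,
      (forall k, (iter (nu k) T @^-1` [set y i]) (z k)) /\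
      (z k @[k --> \oo] --> (0 : X)).

(** Strong transitivity of the [n]-fold product, applied to the open box with all sides [U], gives
    one exponent serving all coordinates. *)
Lemma strongly_product_transitive_preimage (n : nat) (U : set X) (y : 'I_n -> X) :
  strongly_product_transitive T -> (0 < n)%N -> open U -> U !=set0 ->
  exists m, (0 < m)%N /\
    exists x : 'I_n -> X, forall i, U (x i) /\ iter m T (x i) = y i.
Proof.
move=> spt n0 oU [u Uu].
have U0 : [set x : {ptws 'I_n -> X} | forall i, U (x i)] !=set0.
  by exists (fun=> u).
have /seteqP[_ /(_ y I)[m m0 [x Ux xy]]] := spt n n0 _ (open_ptws_box _ oU) U0.
exists m; split=> //; exists x => i; split; first exact: Ux.
by rewrite -xy iter_product_map.
Qed.

Lemma strongly_product_transitive_dense_kernel :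
  strongly_product_transitive T ->
  dense [set x | exists n : nat, (0 < n)%N /\ iter n T x = 0].
Proof.
move=> spt U U0 oU.
have [m [m0 [x xU]]] :=
  @strongly_product_transitive_preimage 1 U (fun=> 0) spt isT oU U0.
by have [Ux x0] := xU ord0; exists (x ord0); split=> //; exists m.
Qed.

Lemma strongly_product_transitive_small_preimages (R : realType) :
  F_space R X -> strongly_product_transitive T -> small_preimages.
Proof.
move=> FX spt n y n0.
have [V nV Vcvg] := @fspace_countable_nbhs R K X 0 FX.
(* Exponent and points are paired so that a single choice over [k] keeps the exponent independent of
   the coordinate. *)
have pre k : exists mx : nat * ('I_n -> X),
    (0 < mx.1)%N /\ forall i, V k (mx.2 i) /\ iter mx.1 T (mx.2 i) = y i.
  have [||m [m0 [x xV]]] :=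
    @strongly_product_transitive_preimage n (V k)° y spt n0.
  - exact: open_interior.
  - by exists 0; exact: nV.
  exists (m, x); split=> // i; have [Vx ?] := xV i.
  by split=> //; exact: interior_subset Vx.
have [f fP] := choice pre.
exists (fun k => (f k).1); split=> [k|i]; first by have [] := fP k.
exists (fun k => (f k).2 i); split=> [k|].
  by have [_ /(_ i)[]] := fP k.
by apply: Vcvg => k; have [_ /(_ i)[]] := fP k.
Qed.

Lemma strongly_product_transitive_of_small_preimages (R : realType) (D : set X) :
  F_space R X -> continuous T -> dense D ->
  (forall x, D x -> exists n : nat, (0 < n)%N /\ iter n T x = 0) ->
  small_preimages -> strongly_product_transitive T.
Proof.
move=> FX cT dD D0 pre n n0 U oU [u Uu]; apply/seteqP; split=> // y _.
have [V nV VU] : exists2 V : 'I_n -> set X, (forall i, nbhs (u i) (V i)) &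
    [set x | forall i, V i (x i)] `<=` U.
  by apply: nbhs_ptws_box; exact: open_nbhs_nbhs.
have Dx i : exists xN : X * nat,
    [/\ D xN.1, (V i)° xN.1, (0 < xN.2)%N & iter xN.2 T xN.1 = 0].
  have [||x [Vx xD]] := dD (V i)°; first by exists (u i); exact: nV.
    exact: open_interior.
  by have [N [N0 xN]] := D0 x xD; exists (x, N).
have [f fP] := choice Dx.
(* From order [M] on, all the chosen points of [D] are sent to 0; the successor makes such an order
   visibly positive. *)
pose M := (\max_(i < n) (f i).2).+1.
have f0 m : (M <= m)%N -> forall i, iter m T (f i).1 = 0.
  move=> Mm i; have [_ _ _] := fP i; apply: iter_eq0_leq.
  by apply: leq_trans Mm; apply: leqW; exact: (leq_bigmax i).
suff [m [z [Mm zP]]] : exists m (z : 'I_n -> X), (M <= m)%N /\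
    forall i, (V i) ((f i).1 + z i) /\ iter m T (z i) = y i.
  exists m; first exact: leq_trans Mm.
  exists (fun i => (f i).1 + z i); first by apply: VU => i; have [] := zP i.
  apply: funext => i; rewrite iter_product_map iter_linearD f0// add0r.
  by have [] := zP i.
(* If all targets vanish, the exponents in (ii) may stay bounded, so [M] and zero perturbations are
   used instead. Otherwise a single nonzero target forces large exponents for every coordinate,
   since [nu] is shared. *)
have [y0|/existsNP[i0 /nesym y0]] := pselect (forall i, y i = 0).
  exists M, (fun=> 0); split=> // i; rewrite addr0 iter_linear0 y0.
  by split=> //; have [_ Vf _ _] := fP i; exact: interior_subset Vf.
have [nu [_ /choice[z zP]]] := pre n y n0.
have nu_big : \forall k \near \oo, (M < nu k)%N.
  have [zy z0] := zP i0.
  exact: small_preimage_exponent_gt cT (@fspace_nbhs_neq R K X _ _ FX y0) zy z0.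
(* Each perturbed point tends to [(f i).1], which is interior to [V i]; finiteness of ['I_n] makes
   one threshold work for all [i]. *)
have z_small : \forall k \near \oo, forall i, V i ((f i).1 + z i k).
  apply: filter_forall => i; have [_ z0] := zP i; have [_ Vf _ _] := fP i.
  have : (f i).1 + z i k @[k --> \oo] --> (f i).1 + 0.
    have c0 : (fun _ : nat => (f i).1) @ \oo --> (f i).1 by exact: cvg_cst.
    apply: (@continuous2_cvg _ X X X _ _ _ _ +%R) => //.
    exact: (@add_continuous X ((f i).1, 0)).
  by rewrite addr0 => /(_ _ Vf).
have [k [nuk Vk]] := filter_ex (filterI nu_big z_small).
exists (nu k), (fun i => z i k); split=> [|i]; first exact: ltnW.
by have [zy _] := zP i; split; [exact: Vk|exact: zy].
Qed.

End equivalence.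

Theorem theorem4p5 (R : realType) (c : bool)
    (X : topologicalLmodType (scalar_field R c)) (X_F_space : F_space R X)
    (X_infinite_dimensional : infinite_dimensional X)
    (X_separable : separable X)
    (T : {linear X -> X}) (T_continuous : continuous T) :
  strongly_product_transitive T <->
  exists D : set X,
    [/\ dense D,
        forall x, D x -> exists n : nat, (0 < n)%N /\ iter n T x = 0
      & forall (n : nat) (y : 'I_n -> X), (0 < n)%N ->
          exists nu : nat -> nat,
            (forall k, (0 < nu k)%N) /\
            forall i : 'I_n, exists z : nat -> X,
              (forall k, (iter (nu k) T @^-1` [set y i]) (z k)) /\
              (z k @[k --> \oo] --> (0 : X))].
Proof.
split=> [spt|[D [dD D0 pre]]].
  (* The largest set allowed by (i) is taken, so only its density and (ii) remain. *)
  exists [set x | exists n : nat, (0 < n)%N /\ iter n T x = 0]; split=> //.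
    exact: strongly_product_transitive_dense_kernel.
  exact: strongly_product_transitive_small_preimages X_F_space spt.
exact: strongly_product_transitive_of_small_preimages X_F_space T_continuous dD D0 pre.
Qed.
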